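(* Let $r\ge4$ and $t\ge1$ be integers. Let $\mathcal{U}$ be a finite set of objects with a symmetric relation ''being $t$-intersecting'', with the terminology below. Let $N_0$ be the size of the extremal $t$-intersecting families, $N_1$ the largest size of a non-extremal maximal $t$-intersecting family (with $N_1=0$ if none exists), suppose any two distinct extremal $t$-intersecting families have at most $N_2$ members in common, that there are at least $\lceil r/3\rceil$ distinct extremal $t$-intersecting families, and at most $M$ maximal $t$-intersecting families. Define \[\Delta=(\log_2 9-3)N_0-r\max(N_1,N_2)-\frac{rN_2}{3}\log_2\mathrm{OPT}(r)-r\log_2 M.\] Fix any assignment $\mathcal{I}\mapsto\mathcal{M}(\mathcal{I})$ of a maximal $t$-intersecting family $\mathcal{M}(\mathcal{I})\supseteq\mathcal{I}$ to each $t$-intersecting family $\mathcal{I}\subseteq\mathcal{U}$. If $\Delta\ge2$, then every family $\mathcal{F}\subseteq\mathcal{U}$ having more than $\frac34$ of the maximum number (over all families in $\mathcal{U}$) of $(r,t)$-colourings is the union of exactly $\lceil r/3\rceil$ extremal $t$-intersecting families, or, only if $r\equiv1\pmod3$, possibly of $\lfloor r/3\rfloor$ extremal $t$-intersecting families. Furthermore, the proportion of atypical colourings among the $(r,t)$-colourings of such $\mathcal{F}$ is smaller than $2^{2-\Delta}/3$.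
   Context: A family $\mathcal{F}\subseteq\mathcal{U}$ is $t$-intersecting if every two distinct members are $t$-intersecting (the empty family is $t$-intersecting); it is maximal if not properly contained in another $t$-intersecting family in $\mathcal{U}$; it is extremal if it has maximum size among $t$-intersecting families in $\mathcal{U}$. An $(r,t)$-colouring of $\mathcal{F}$ is a map $\mathcal{F}\to\{1,\dots,r\}$ whose colour classes $\mathcal{I}_1,\dots,\mathcal{I}_r$ are all $t$-intersecting. $\mathrm{OPT}(r)$ is the maximum of $\prod_{i=1}^s m_i$ over all $s\ge0$ and positive integers $m_1,\dots,m_s$ with $\sum m_i=r$; a vector $(m_1,\dots,m_s)$ of positive integers summing to $r$ attaining this maximum is an optimal solution. To an $(r,t)$-colouring with colour classes $\mathcal{I}_1,\dots,\mathcal{I}_r$ associate the sequence $(\mathcal{M}(\mathcal{I}_1),\dots,\mathcal{M}(\mathcal{I}_r))$; let $\mathcal{M}'_1,\dots,\mathcal{M}'_{s}$ be the distinct families appearing in it and $m_i$ the number of times $\mathcal{M}'_i$ appears. The colouring is typical if $(m_1,\dots,m_s)$ is an optimal solution and each $\mathcal{M}'_i$ is an extremal $t$-intersecting family with $|\mathcal{F}\cap\mathcal{M}'_i|>r\max(N_1,N_2)$; otherwise it is atypical. *)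

(* Defs.v *)
From mathcomp Require Import all_boot all_order all_algebra.
From mathcomp Require Import reals exp.

Set Implicit Arguments.
Unset Strict Implicit.
Unset Printing Implicit Defensive.

Import Order.TTheory GRing.Theory Num.Theory.

Definition ceil3 (r : nat) : nat := (r + 2) %/ 3.

Definition solution (r : nat) (m : seq nat) : bool :=
  all (fun k => 0 < k) m && (\sum_(k <- m) k == r).

(* A solution for r has at most r parts, each at most r, so bounding the
   length and the entries loses nothing: see OPT_ge and OPT_attained. *)
Definition OPT (r : nat) : nat :=
  \max_(s < r.+1) \max_(m : s.-tuple 'I_r.+1 | solution r (map val m))
    \prod_(k <- map val m) k.

Definition optimal_solution (r : nat) (m : seq nat) : bool :=
  solution r m && (\prod_(k <- m) k == OPT r).

Lemma OPT_ge (r : nat) (m : seq nat) :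
  solution r m -> \prod_(k <- m) k <= OPT r.
Proof.
move=> solm; have /andP[posm /eqP summ] := solm.
have size_le : size m < r.+1.
  rewrite ltnS -summ; elim: m posm {solm summ} => [|k m IHm] //=.
  by case/andP=> k_gt0 /IHm IH; rewrite big_cons -add1n leq_add.
have m_le : all (fun k => k < r.+1) m.
  apply/allP=> k km; rewrite ltnS -summ (big_rem k) //=.
  exact: leq_addr.
have mE : map val (map (@inord r) m) = m.
  rewrite -map_comp -[RHS]map_id; apply/eq_in_map=> k km /=.
  by rewrite inordK // (allP m_le).
have sz : size (map (@inord r) m) == size m by rewrite size_map.
apply: leq_trans (leq_bigmax (Ordinal size_le)) => /=.
apply: leq_trans (leq_bigmax_cond (Tuple sz) _) => /=; rewrite mE //.
Qed.

Lemma OPT_attained (r : nat) :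
  exists2 m, solution r m & \prod_(k <- m) k = OPT r.
Proof.
have sol1 : solution r (nseq r 1).
  rewrite /solution all_nseq orbT /=.
  by rewrite big_nseq iter_addn addn0 mul1n.
have OPT_gt0 : 0 < OPT r.
  by apply: leq_trans (OPT_ge sol1); rewrite big_nseq iter_muln muln1 exp1n.
rewrite /OPT in OPT_gt0 *.
have [s sE] := @bigop.eq_bigmax _ (fun s : 'I_r.+1 =>
  \max_(m : s.-tuple 'I_r.+1 | solution r (map val m))
    \prod_(k <- map val m) k) (ltac:(by rewrite card_ord)).
rewrite sE in OPT_gt0 *.
have c_gt0 : 0 < #|[pred m : s.-tuple 'I_r.+1 | solution r (map val m)]|.
  rewrite lt0n; apply/eqP=> /card0_eq c0; move: OPT_gt0.
  by rewrite big_pred0.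
have [m solm mE] := bigop.eq_bigmax_cond (fun m : s.-tuple 'I_r.+1 =>
  \prod_(k <- map val m) k) c_gt0.
by exists (map val m).
Qed.

Section Families.

Variables (U : finType) (tint : rel U).

Definition t_intersecting (F : {set U}) : bool :=
  [forall A in F, forall B in F, (A != B) ==> tint A B].

Definition maximal (F : {set U}) : bool := maxset t_intersecting F.

Definition N0 : nat := \max_(F : {set U} | t_intersecting F) #|F|.

Definition extremal (F : {set U}) : bool :=
  t_intersecting F && (#|F| == N0).

(* \max over an empty range is 0. *)
Definition N1 : nat :=
  \max_(F : {set U} | maximal F && ~~ extremal F) #|F|.

Definition colour_class (r : nat) (F : {set U})
    (c : {ffun {x : U | x \in F} -> 'I_r}) (i : 'I_r) : {set U} :=
  [set val x | x : {x : U | x \in F} & c x == i].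

Definition colourings (r : nat) (F : {set U}) :
    {set {ffun {x : U | x \in F} -> 'I_r}} :=
  [set c | [forall i, t_intersecting (colour_class c i)]].

Definition max_colourings (r : nat) : nat :=
  \max_(F : {set U}) #|colourings r F|.

Definition assignment (Mx : {set U} -> {set U}) : Prop :=
  forall I : {set U}, t_intersecting I -> maximal (Mx I) /\ I \subset Mx I.

Section Typical.

Variables (Mx : {set U} -> {set U}) (N2 r : nat) (F : {set U}).

Definition class_seq (c : {ffun {x : U | x \in F} -> 'I_r}) : seq {set U} :=
  [seq Mx (colour_class c i) | i <- enum 'I_r].

Definition typical (c : {ffun {x : U | x \in F} -> 'I_r}) : bool :=
  let Ms := undup (class_seq c) in
  optimal_solution r [seq count_mem A (class_seq c) | A <- Ms] &&
  all (fun A => extremal A && (r * maxn N1 N2 < #|F :&: A|)) Ms.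

Definition atypical_colourings : {set {ffun {x : U | x \in F} -> 'I_r}} :=
  [set c in colourings r F | ~~ typical c].

End Typical.

Definition union_of_extremal (k : nat) (F : {set U}) : Prop :=
  exists S : {set {set U}},
    [/\ #|S| = k, (forall A, A \in S -> extremal A) & F = cover S].

Local Open Scope ring_scope.

Definition log2 (R : realType) (x : R) : R := ln x / ln 2.

Definition Delta (R : realType) (r N2 M : nat) : R :=
  (log2 9 - 3) * N0%:R - r%:R * (maxn N1 N2)%:R
  - r%:R * N2%:R / 3 * log2 (OPT r)%:R - r%:R * log2 M%:R.

End Families.

(* Main.v *)
Require Import Defs.
From mathcomp Require Import all_boot all_order all_algebra.
From mathcomp Require Import reals sequences exp.
From mathcomp Require Import zify ring lra.

(* If the colour classes of a colouring of F lie in the maximal families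
   M_1, ..., M_r, then x in F has at most d(x) = #{i | x in M_i} possible colours,
   so at most \prod_(x in F) d(x) colourings have the sequence M_1, ..., M_r.
   If some F :&: M_i is small this product is bounded through d <= 3^(d/3); if all
   M_i are extremal, few members lie in two distinct M_i, so the product is
   essentially (\prod m_j)^N0, and a non-optimal vector of multiplicities m_j loses
   a factor 8/9.  Both bounds are compared with the number of colourings of a union
   of extremal families, which is at least OPT(r)^(N0 - (r/3) N2); this bounds the
   atypical colourings.  All typical colourings of F use the same extremal families.
   If one of these had a member y outside F, each typical colouring would extend to
   y in at least two ways, giving y |: F more than the maximum number of colourings. *)

Set Implicit Arguments.
Unset Strict Implicit.
Unset Printing Implicit Defensive.

Import Order.TTheory GRing.Theory Num.Theory.

(** * Optimal solutions *)

Lemma solution_gt0 r m : solution r m -> 0 < \prod_(k <- m) k.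
Proof.
by case/andP=> /allP posm _; rewrite big_seq; apply: prodn_cond_gt0 => k; apply: posm.
Qed.

Lemma OPT_gt0 r : 0 < OPT r.
Proof. by have [m /solution_gt0 mgt0 <-] := OPT_attained r. Qed.

(** A part 4 counts as 2 + 2, which has the same sum and product. For [1 < r] the balanced solutions
    turn out to be exactly the optimal ones. *)
Definition balanced (m : seq nat) : bool :=
  all (fun k => 2 <= k <= 4) m && (count_mem 2 m + 2 * count_mem 4 m <= 2).

Lemma sum_parts_2_4 m : all (fun k => 2 <= k <= 4) m ->
  [/\ \sum_(k <- m) k = 2 * (count_mem 2 m + 2 * count_mem 4 m) + 3 * count_mem 3 m,
   \prod_(k <- m) k = 2 ^ (count_mem 2 m + 2 * count_mem 4 m) * 3 ^ count_mem 3 m &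
   size m = count_mem 2 m + count_mem 3 m + count_mem 4 m].
Proof.
elim: m => [|k m IH] /=; first by rewrite !big_nil.
case/andP=> hk /IH[IH1 IH2 IH3]; rewrite !big_cons IH1 IH2 IH3.
have [->|[->|->]] : k = 2 \/ k = 3 \/ k = 4 by lia.
all: rewrite /= ?add0n ?mulnDr ?expnD ?expn1; split; rewrite ?expnM; lia.
Qed.

Lemma solution_rem r m p q : solution r m -> p \in m ->
  all (fun k => 0 < k) q -> \sum_(k <- q) k = p ->
  (\prod_(k <- q) k) * \prod_(k <- rem p m) k <= OPT r.
Proof.
case/andP=> /allP posm /eqP summ pm posq sumq.
rewrite -big_cat; apply: OPT_ge; rewrite /solution all_cat posq /=.
apply/andP; split; first by apply/allP=> k /mem_rem; apply: posm.
by rewrite big_cat /= sumq -summ (big_rem p pm) /=.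
Qed.

(* A part p >= 5 is improved by splitting off a 3, a part 1 by merging it with
   another part, and 2 + 2 + 2 (where 4 counts as 2 + 2) by 3 + 3; each of
   these gains a factor of at least 9/8. *)
Lemma balanced_or_gap r m : 1 < r -> solution r m ->
  9 * \prod_(k <- m) k <= 8 * OPT r \/ balanced m.
Proof.
move=> r_gt1 solm; have /andP[posm /eqP summ] := solm.
have [/hasP[p pm p_ge5]|no5] := boolP (has (leq 5) m).
  left; rewrite (big_rem p pm) /=.
  have := @solution_rem r m p [:: 3; p - 3] solm pm.
  rewrite !big_cons !big_nil muln1 addn0 /= => /(_ _ _)H.
  apply: leq_trans (leq_mul (leqnn 8) (H _ _)); [|lia..].
  (* Splitting gains enough because [9 * p <= 24 * (p - 3)] for [p >= 5]. *)
  by rewrite !mulnA; apply: leq_mul => //; lia.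
have [m1|no1] := boolP (1 \in m).
  left; case em: (rem 1 m) => [|a m'].
    by move: r_gt1; rewrite -summ (big_rem 1 m1) /= em big_nil.
  have am : a \in m by apply: (@mem_rem _ 1); rewrite em mem_head.
  have a_le4 : a <= 4.
    by rewrite leqNgt; apply: contra no5 => ha; apply/hasP; exists a.
  have a_gt0 := allP posm _ am.
  have sol' : solution r (a.+1 :: m').
    apply/andP; split.
      apply/allP=> k; rewrite inE => /predU1P[-> //|km'].
      by apply: (allP posm); apply: (@mem_rem _ 1); rewrite em inE km' orbT.
    by rewrite -summ (big_rem 1 m1) /= em !big_cons.
  have := OPT_ge sol'; rewrite (big_rem 1 m1) /= em !big_cons mul1n => H.
  apply: leq_trans (leq_mul (leqnn 8) H).
  by rewrite !mulnA; apply: leq_mul => //; lia.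
have all24 : all (fun k => 2 <= k <= 4) m.
  apply/allP=> k km; have := allP posm k km.
  have : ~~ (4 < k) by apply: contra no5 => ha; apply/hasP; exists k.
  have : k != 1 by apply: contraNneq no1 => <-.
  by lia.
have [le2|gt2] := leqP (count_mem 2 m + 2 * count_mem 4 m) 2.
  by right; rewrite /balanced all24.
left; have [sumE prodE _] := sum_parts_2_4 all24.
move: gt2 sumE prodE; set a := count_mem 2 m + 2 * count_mem 4 m; set b := count_mem 3 m => a_gt2 sumE ->.
(* With each 4 read as 2 + 2, three of the [a] twos become two threes: the product grows by exactly
   9/8. *)
have sol' : solution r (nseq (a - 3) 2 ++ nseq (b + 2) 3).
  rewrite /solution all_cat !all_nseq /= !orbT /=.
  by rewrite big_cat /= !big_nseq !iter_addn !addn0 -summ sumE; lia.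
have := OPT_ge sol'; rewrite big_cat /= !big_nseq !iter_muln !muln1 => H.
apply: leq_trans (leq_mul (leqnn 8) H).
by rewrite -{1}(subnK a_gt2) !expnD; lia.
Qed.

Lemma optimal_balanced r m : 1 < r -> optimal_solution r m -> balanced m.
Proof.
move=> r_gt1 /andP[solm /eqP prodm].
by case: (balanced_or_gap r_gt1 solm) => //; rewrite prodm; have := OPT_gt0 r; lia.
Qed.

Lemma balanced_prod r m : solution r m -> balanced m ->
  exists a b, [/\ a <= 2, r = 2 * a + 3 * b & \prod_(k <- m) k = 2 ^ a * 3 ^ b].
Proof.
case/andP=> _ /eqP <- /andP[m24 a_le2]; have [-> -> _] := sum_parts_2_4 m24.
by exists (count_mem 2 m + 2 * count_mem 4 m), (count_mem 3 m).
Qed.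

Lemma OPT_eq r : 1 < r ->
  exists a b, [/\ a <= 2, r = 2 * a + 3 * b & OPT r = 2 ^ a * 3 ^ b].
Proof.
move=> r_gt1; have [m solm prodm] := OPT_attained r.
have optm : optimal_solution r m by rewrite /optimal_solution solm prodm eqxx.
by rewrite -prodm; apply: balanced_prod solm (optimal_balanced r_gt1 optm).
Qed.

(** With [a <= 2], the equation [r = 2 * a + 3 * b] determines [a] and [b], so all balanced
    solutions have the same product. *)
Lemma balanced_optimal r m : 1 < r -> solution r m -> balanced m ->
  optimal_solution r m.
Proof.
move=> r_gt1 solm balm; rewrite /optimal_solution solm /=; apply/eqP.
have [a [b [a2 rE ->]]] := balanced_prod solm balm.
have [a' [b' [a2' rE' ->]]] := OPT_eq r_gt1.
have -> : a = a' by lia.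
by have -> : b = b' by lia.
Qed.

Lemma nonoptimal_gap r m : 1 < r -> solution r m -> ~~ optimal_solution r m ->
  9 * \prod_(k <- m) k <= 8 * OPT r.
Proof.
move=> r_gt1 solm noptm; have [//|balm] := balanced_or_gap r_gt1 solm.
by rewrite balanced_optimal in noptm.
Qed.

Lemma optimal_parts_ge2 r m : 1 < r -> optimal_solution r m ->
  forall k, k \in m -> 1 < k.
Proof.
move=> r_gt1 /(optimal_balanced r_gt1) /andP[/allP m24 _] k /m24.
by case/andP.
Qed.

(** The exceptional size comes from a single part 4 standing in place of 2 + 2, which forces [r] to
    be 1 modulo 3. *)
Lemma size_optimal r m : 1 < r -> optimal_solution r m ->
  size m = ceil3 r \/ r = 1 %[mod 3] /\ size m = r %/ 3.
Proof.
move=> r_gt1 optm; have /andP[m24 a_le2] := optimal_balanced r_gt1 optm.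
have [sumE _ ->] := sum_parts_2_4 m24.
have /andP[/andP[_ /eqP summ] _] := optm; rewrite /ceil3.
by move: summ; rewrite sumE; lia.
Qed.

(** This is the cube of 9 * 3^((r-1)/3) <= 8 * OPT(r): covering by only r - 1 families instead of r
    costs a factor 8/9. *)
Lemma expn3_le_OPT r : 1 < r -> 3 ^ (r + 5) <= 512 * OPT r ^ 3.
Proof.
move=> r_gt1; have [a [b [a2 -> ->]]] := OPT_eq r_gt1.
rewrite expnMn -!expnM (mulnC b 3) mulnA !expnD mulnAC leq_mul2r; apply/orP; right.
by case: a a2 => [|[|[|//]]] _.
Qed.

(** The bound n <= 3^(n/3), cubed to stay in the integers. Equality holds at 3, and
    [n.+1 ^ 3 <= 3 * n ^ 3] from there on. *)
Lemma expn_cube_le n : n ^ 3 <= 3 ^ n.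
Proof.
have [n_lt3|] := ltnP n 3; first by case: n n_lt3 => [|[|[|]]].
elim: n => // n IH; rewrite leq_eqVlt ltnS => /predU1P[<- //|n_ge3].
have := IH n_ge3; rewrite [3 ^ n.+1]expnS => le3.
apply: leq_trans (leq_mul (leqnn 3) le3); rewrite !expnS expn0 !muln1; nia.
Qed.

(** Each part satisfies [k ^ 3 <= 3 ^ k], and a part 1 leaves a factor 3 to spare. *)
Lemma prod_cube_le (m : seq nat) :
  (\prod_(k <- m) k) ^ 3 * 3 ^ count_mem 1 m <= 3 ^ (\sum_(k <- m) k).
Proof.
elim: m => [|k m IH] /=; first by rewrite !big_nil.
rewrite !big_cons expnMn !expnD.
have -> : forall a b c d, a * b * (c * d) = (a * c) * (b * d) by move=> *; lia.
apply: leq_mul => //; case: eqP => [->//|_]; rewrite muln1; exact: expn_cube_le.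
Qed.

Lemma sum_le_prod (T : eqType) (s : seq T) (a : T -> nat) :
  {in s, forall i, 1 < a i} -> \sum_(i <- s) a i <= \prod_(i <- s) a i.
Proof.
elim: s => [|i s IH] a2; first by rewrite !big_nil.
have ai2 := a2 i (mem_head _ _).
have as2 j : j \in s -> 1 < a j by move=> js; apply: a2; rewrite inE js orbT.
have := IH as2; rewrite !big_cons.
case: s {IH a2} as2 => [|j s] as2; first by rewrite !big_nil; lia.
suff : 1 < \prod_(k <- j :: s) a k by nia.
have := as2 j (mem_head _ _); rewrite big_cons.
suff : 0 < \prod_(k <- s) a k by nia.
rewrite big_seq; apply: prodn_cond_gt0 => k ks.
by apply: ltnW; apply: as2; rewrite inE ks orbT.
Qed.

(** * Coverage of a set by a sequence of families *)

Lemma count_undup (T : eqType) (p : pred T) (l : seq T) :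
  count p l = \sum_(i <- undup l | p i) count_mem i l.
Proof.
rewrite -sum1_count -big_undup_iterop_count /=; apply: eq_bigr => i _.
by rewrite Monoid.iteropE iter_addn addn0 mul1n.
Qed.

Section Coverage.

Variable U : finType.
Implicit Types (F A B : {set U}) (l : seq {set U}) (x : U).

(** The number d(x) of possible colours of [x]; a family repeated in [l] counts with its
    multiplicity. *)
Definition coverage l x : nat := count (fun A : {set U} => x \in A) l.

(** For [A] in [l], a member of [A] outside this set has coverage equal to the multiplicity of
    [A]. *)
Definition shared l A : {set U} :=
  [set x in A | has (fun B : {set U} => (B != A) && (x \in B)) l].

Lemma coverage_undup l x :
  coverage l x = \sum_(A <- undup l | x \in A) count_mem A l.
Proof. exact: count_undup. Qed.

Lemma sum_coverage F l : \sum_(x in F) coverage l x = \sum_(A <- l) #|F :&: A|.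
Proof.
under eq_bigr do rewrite /coverage -sum1_count big_mkcond.
rewrite exchange_big; apply: eq_bigr => A _.
by rewrite -big_mkcondr /= -sum1_card; apply: eq_bigl => x; rewrite inE.
Qed.

Lemma prod_exchange F l (g : U -> {set U} -> nat) :
  \prod_(x in F) \prod_(A <- l | x \in A) g x A =
  \prod_(A <- l) \prod_(x in F :&: A) g x A.
Proof.
rewrite (exchange_big_dep xpredT) //=; apply: eq_bigr => A _.
by apply: eq_bigl => x; rewrite inE.
Qed.

Lemma shared_undup l x A : 1 < size [seq B : {set U} <- undup l | x \in B] ->
  x \in A -> x \in shared l A.
Proof.
move=> size_gt1 xA; rewrite inE xA; apply/hasP.
have := filter_uniq (fun B : {set U} => x \in B) (undup_uniq l).
have sub B : B \in [seq B : {set U} <- undup l | x \in B] -> (B \in l) && (x \in B).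
  by rewrite mem_filter mem_undup andbC.
case: [seq _ <- _ | _] size_gt1 sub => [|B [|C s]] //= _ sub /andP[].
rewrite inE negb_or => /andP[BC _] _.
have /andP[Bl xB] := sub B (mem_head _ _).
have /andP[Cl xC] : (C \in l) && (x \in C) by apply: sub; rewrite !inE eqxx orbT.
have [eBA|BA] := eqVneq B A; last by exists B; rewrite ?BA.
by exists C; rewrite // -eBA eq_sym BC.
Qed.

Lemma not_shared l x A : [seq B : {set U} <- undup l | x \in B] = [:: A] -> x \notin shared l A.
Proof.
move=> lE; rewrite inE negb_and; apply/orP; right; apply/hasPn => B Bl.
have : (B \in [seq B : {set U} <- undup l | x \in B]) = (B == A) by rewrite lE inE.
by rewrite mem_filter mem_undup Bl andbT => ->; rewrite andNb.
Qed.

Lemma count_mem_undup_gt0 l A : A \in undup l -> 0 < count_mem A l.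
Proof. by rewrite mem_undup -has_count has_pred1. Qed.

(* Numbers a, b >= 2 satisfy a + b <= a * b, so a sum of multiplicities is at most
   their product once every multiplicity 1 has been doubled. *)
Lemma coverage_le l x :
  coverage l x <= \prod_(A <- undup l | x \in A)
    (count_mem A l * (if (count_mem A l == 1) && (x \in shared l A) then 2 else 1)).
Proof.
rewrite coverage_undup -big_filter -[X in _ <= X]big_filter.
case lE: [seq _ <- _ | _] => [|A [|B s]]; first by rewrite !big_nil.
  by rewrite !big_seq1 (negPf (not_shared lE)) andbF muln1.
have size_gt1 : 1 < size [seq B : {set U} <- undup l | x \in B] by rewrite lE.
rewrite -{}lE.
apply: leq_trans (sum_le_prod _).
  by apply: leq_sum => C _; case: ifP => _; rewrite ?muln1 // leq_pmulr.
move=> C; rewrite mem_filter => /andP[xC /count_mem_undup_gt0].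
by rewrite (shared_undup size_gt1 xC) andbT; case: eqP; lia.
Qed.

(** If [x] lies in one distinct family only, its coverage is that multiplicity. Otherwise [x] is
    shared, and the second factor on the right already equals the left side. *)
Lemma coverage_ge l x : has (fun A : {set U} => x \in A) l ->
  \prod_(A <- undup l | x \in A) count_mem A l <=
  coverage l x * \prod_(A <- undup l | x \in A)
     (if x \in shared l A then count_mem A l else 1).
Proof.
rewrite has_count => cov_gt0.
have [size_gt1|size_le1] := ltnP 1 (size [seq B : {set U} <- undup l | x \in B]).
  rewrite [X in _ <= _ * X](eq_bigr (fun A => count_mem A l)).
    by rewrite leq_pmull.
  by move=> A xA; rewrite (shared_undup size_gt1 xA).
apply: (@leq_trans (coverage l x)); last first.
  rewrite leq_pmulr // big_seq_cond; apply: prodn_cond_gt0 => A /andP[Al _].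
  by case: ifP => // _; apply: count_mem_undup_gt0.
move: cov_gt0; rewrite -/(coverage l x) coverage_undup.
rewrite -[\sum_(_ <- _ | _) _]big_filter -[\prod_(_ <- _ | _) _]big_filter.
by case: [seq _ <- _ | _] size_le1 => [|A [|B s]] //=; rewrite ?big_nil ?big_seq1.
Qed.

Lemma prod_coverage_le F l :
  \prod_(x in F) coverage l x <=
  (\prod_(A <- undup l) count_mem A l ^ #|F :&: A|) *
  \prod_(A <- undup l | count_mem A l == 1) 2 ^ #|shared l A|.
Proof.
apply: leq_trans (leq_prod (fun x _ => coverage_le l x)) _.
rewrite prod_exchange [X in _ <= _ * X]big_mkcond -big_split /=.
apply: leq_prod => A _; rewrite big_split /= prod_nat_const leq_mul2l.
apply/orP; right; case: eqP => /= _; last by rewrite big1.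
rewrite -big_mkcondr /= -prod_nat_const.
rewrite [X in _ <= X]big_mkcond [X in X <= _]big_mkcond; apply: leq_prod => x _.
by case: (x \in shared l A); rewrite ?andbF //; case: ifP.
Qed.

Lemma prod_coverage_ge l :
  \prod_(A <- undup l) count_mem A l ^ #|A| <=
  (\prod_(x in cover [set A in l]) coverage l x) *
  \prod_(A <- undup l) count_mem A l ^ #|shared l A|.
Proof.
set G := cover _.
have memG x : (x \in G) = has (fun A : {set U} => x \in A) l.
  apply/bigcupP/hasP => [[A]|[A Al xA]]; first by rewrite inE; exists A.
  by exists A; rewrite ?inE.
have sG A : A \in l -> A \subset G.
  by move=> Al; apply: bigcup_sup; rewrite inE.
have -> : \prod_(A <- undup l) count_mem A l ^ #|A| =
          \prod_(x in G) \prod_(A <- undup l | x \in A) count_mem A l.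
  rewrite prod_exchange big_seq [RHS]big_seq; apply: eq_bigr => A.
  by rewrite mem_undup => /sG/setIidPr ->; rewrite prod_nat_const.
have -> : \prod_(A <- undup l) count_mem A l ^ #|shared l A| =
          \prod_(x in G) \prod_(A <- undup l | x \in A)
     (if x \in shared l A then count_mem A l else 1).
  rewrite prod_exchange big_seq [RHS]big_seq; apply: eq_bigr => A.
  rewrite mem_undup => /sG/setIidPr ->; rewrite -big_mkcondr /= -prod_nat_const.
  by apply: eq_bigl => x; rewrite !inE andbA andbb.
by rewrite -big_split /=; apply: leq_prod => x; rewrite memG; apply: coverage_ge.
Qed.

Lemma card_shared_le n l A : A \in l ->
  {in l, forall B, B != A -> #|A :&: B| <= n} ->
  #|shared l A| <= (size (undup l)).-1 * n.
Proof.
move=> Al le_n; have Au : A \in undup l by rewrite mem_undup.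
have sub : shared l A \subset \bigcup_(B <- rem A (undup l)) (A :&: B).
  apply/subsetP=> x; rewrite inE => /andP[xA /hasP[B Bl /andP[BA xB]]].
  have Br : B \in rem A (undup l).
    by rewrite mem_rem_uniq ?undup_uniq // inE BA mem_undup.
  by rewrite (big_rem B Br) /= !inE xA xB.
apply: leq_trans (subset_leq_card sub) _; rewrite -(size_rem Au).
have : {subset rem A (undup l) <= [pred B | (B != A) && (B \in l)]}.
  by move=> B; rewrite mem_rem_uniq ?undup_uniq // !inE mem_undup.
elim: (rem _ _) => [|B s IH] sub_s; first by rewrite big_nil cards0.
rewrite big_cons mulSn (leq_trans (leq_card_setU _ _)) // leq_add //.
  by have /andP[BA Bl] := sub_s B (mem_head _ _); apply: le_n.
by apply: IH => C Cs; apply: sub_s; rewrite inE Cs orbT.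
Qed.

Lemma prod_coverage_cube_le F l :
  (\prod_(x in F) coverage l x) ^ 3 <= 3 ^ (\sum_(A <- l) #|F :&: A|).
Proof.
rewrite -sum_coverage expn_sum (big_morph (expn^~ 3) (fun a b => expnMn a b 3) (exp1n 3)).
by apply: leq_prod => x _; apply: expn_cube_le.
Qed.

Definition multiplicities l : seq nat := [seq count_mem A l | A <- undup l].

Lemma multiplicities_solution l : solution (size l) (multiplicities l).
Proof.
apply/andP; split.
  by apply/allP=> _ /mapP[A Al ->]; apply: count_mem_undup_gt0.
by rewrite big_map -count_undup count_predT.
Qed.

(** Serves to realise an optimal solution by distinct extremal families, each repeated as often as
    its part prescribes. *)
Lemma exists_multiplicities (s : seq {set U}) (m : seq nat) :
  uniq s -> size m <= size s -> all (fun k => 0 < k) m ->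
  exists l, [/\ {subset l <= s}, multiplicities l = m & size l = \sum_(k <- m) k].
Proof.
elim: m s => [|k m IH] s; first by exists [::]; rewrite big_nil.
case: s => //= A s /andP[As us]; rewrite ltnS => size_le /andP[k_gt0 posm].
have [l [sub_l mult_l size_l]] := IH _ us size_le posm.
have Al : A \notin l by apply: contra As => /sub_l.
exists (nseq k A ++ l); split.
- move=> B; rewrite mem_cat mem_nseq inE => /orP[/andP[_ ->] //|/sub_l ->].
  by rewrite orbT.
- have uE : undup (nseq k A ++ l) = A :: undup l.
    case: k k_gt0 => // k _; elim: k => [|k IHk] /=; first by rewrite (negPf Al).
    by rewrite /= in IHk; rewrite inE eqxx.
  rewrite /multiplicities uE /= count_cat count_nseq /= eqxx mul1n.
  rewrite (count_memPn Al) addn0 -mult_l; congr (_ :: _).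
  apply/eq_in_map => B; rewrite mem_undup => Bl; rewrite count_cat count_nseq /=.
  by case: eqP => [eAB|_]; rewrite ?mul0n //; rewrite eAB Bl in Al.
- by rewrite size_cat size_nseq size_l big_cons.
Qed.

End Coverage.

(** * Coverage products compared with the power of OPT(r) *)

Lemma expn_homo e : {homo expn^~ e : m n / m <= n}.
Proof. by case: e => [|e] m n mn; [rewrite !expn0 | rewrite leq_exp2r]. Qed.

Section Bounds.

Variables (U : finType) (tint : rel U) (N2 r : nat).
Hypothesis extremalI_le : forall A B : {set U},
  extremal tint A -> extremal tint B -> A != B -> #|A :&: B| <= N2.
Hypothesis r_gt1 : 1 < r.
Implicit Types (F A B : {set U}) (l : seq {set U}).

Let Nmax := maxn (N1 tint) N2.

Lemma t_intersecting_sub A B : A \subset B -> t_intersecting tint B ->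
  t_intersecting tint A.
Proof.
move=> /subsetP AB /forall_inP tB; apply/forall_inP=> x /AB/tB/forall_inP tx.
by apply/forall_inP=> y /AB/tx.
Qed.

Lemma maximal_t_intersecting A : maximal tint A -> t_intersecting tint A.
Proof. by case/maxsetP. Qed.

Lemma card_t_intersecting A : t_intersecting tint A -> #|A| <= N0 tint.
Proof. by move=> tA; exact: (@bigop.leq_bigmax_cond _ _ (fun A : {set U} => #|A|) A). Qed.

Lemma maximal_large_extremal A : maximal tint A -> N1 tint < #|A| -> extremal tint A.
Proof.
move=> maxA; apply: contraTT => nextA; rewrite -leqNgt.
apply: (@bigop.leq_bigmax_cond _ _ (fun A : {set U} => #|A|) A).
by rewrite maxA.
Qed.

(** The total coverage is at most (r-1) N0 + r Nmax, and the product of the coverages is at most 3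
    to a third of that; [expn3_le_OPT] turns this into the factor 8/9. All is cubed to avoid
    fractional exponents. *)
Lemma prod_coverage_small F l A : size l = r ->
  {in l, forall B, #|B| <= N0 tint} -> A \in l -> #|F :&: A| <= r * Nmax ->
  (\prod_(x in F) coverage l x) * 9 ^ N0 tint <=
  OPT r ^ N0 tint * 8 ^ N0 tint * 2 ^ (r * Nmax).
Proof.
move=> size_l le_N0 Al small; rewrite -(@leq_exp2r _ _ 3) // !expnMn.
have sum_le : \sum_(B <- l) #|F :&: B| <= r * Nmax + r.-1 * N0 tint.
  rewrite (big_rem A Al) /= leq_add // -size_l -(size_rem Al) -sum1_size big_distrl /=.
  rewrite [X in X <= _]big_seq [X in _ <= X]big_seq; apply: leq_sum => B /mem_rem Bl.
  by rewrite mul1n (leq_trans _ (le_N0 B Bl)) // subset_leq_card // subsetIr.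
apply: leq_trans (leq_mul (prod_coverage_cube_le F l) (leqnn _)) _.
apply: leq_trans (leq_mul (_ : _ <= 3 ^ (r * Nmax + r.-1 * N0 tint)) (leqnn _)) _.
  by rewrite leq_exp2l.
(* The factor [3 ^ (r * Nmax)] is absorbed by the cube of [2 ^ (r * Nmax)]; a comparison of [N0]-th
   powers remains. *)
rewrite expnD -mulnA mulnC; apply: leq_mul; last first.
  by rewrite (expnAC _ _ 3); apply: expn_homo.
rewrite !(expnAC _ _ 3) expnM -!expnMn.
apply: expn_homo.
have := expn3_le_OPT r_gt1; rewrite -[r in r + 5](prednK (ltnW r_gt1)) addSnnS expnD.
by rewrite expnMn (mulnC 512).
Qed.

(** Each family meets [F] in at most [N0] members, and only the families of multiplicity 1 pay a
    factor 2 for each of their at most [r * N2] shared members. *)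
Lemma prod_coverage_extremal F l : size l = r -> {in l, forall A, extremal tint A} ->
  \prod_(x in F) coverage l x <=
  (\prod_(k <- multiplicities l) k) ^ N0 tint *
  2 ^ (count_mem 1 (multiplicities l) * (r * N2)).
Proof.
move=> size_l ext_l; apply: leq_trans (prod_coverage_le F l) _; apply: leq_mul.
  rewrite big_map (big_morph (expn^~ (N0 tint)) (fun a b => expnMn a b _) (exp1n _)).
  rewrite big_seq [X in _ <= X]big_seq; apply: leq_prod => A Al.
  rewrite leq_pexp2l ?count_mem_undup_gt0 //.
  have /ext_l/andP[/card_t_intersecting A_le _] : A \in l by rewrite -mem_undup.
  by apply: leq_trans A_le; rewrite subset_leq_card // subsetIr.
rewrite -expn_sum leq_exp2l // count_map -sum1_count big_distrl /=.
rewrite big_seq_cond [X in _ <= X]big_seq_cond; apply: leq_sum => A /andP[Al _].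
rewrite mul1n mem_undup in Al *.
apply: leq_trans (card_shared_le (n := N2) Al _) _.
  by move=> B Bl BA; apply: extremalI_le; rewrite ?ext_l // eq_sym.
rewrite leq_mul2r -size_l (leq_trans (leq_pred _)) ?size_undup ?orbT //.
Qed.

(* A multiplicity 1 costs a factor 3^(N0/3) in the product of the multiplicities,
   which pays for the 2^(r * N2) lost on shared members. *)
Lemma prod_coverage_nonoptimal F l : size l = r -> {in l, forall A, extremal tint A} ->
  ~~ optimal_solution r (multiplicities l) -> 2 * (r * N2) <= N0 tint ->
  (\prod_(x in F) coverage l x) * 9 ^ N0 tint <=
  OPT r ^ N0 tint * 8 ^ N0 tint * 2 ^ (r * Nmax).
Proof.
move=> size_l ext_l nopt N0_ge.
have le_max : r * N2 <= r * Nmax by rewrite leq_mul2l leq_maxr orbT.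
apply: (@leq_trans (OPT r ^ N0 tint * 8 ^ N0 tint * 2 ^ (r * N2))); last first.
  by rewrite leq_mul2l leq_exp2l ?le_max ?orbT.
apply: leq_trans (leq_mul (prod_coverage_extremal F size_l ext_l) (leqnn _)) _.
have sol := multiplicities_solution l; rewrite size_l in sol.
have := nonoptimal_gap r_gt1 sol nopt; have := prod_cube_le (multiplicities l).
have /andP[_ /eqP ->] := sol.
(* Without multiplicity 1 the gap 8/9 suffices. With [u.+1] of them, one pays for the factor 8/9 and
   the other [u] pay for sharing in [u] families; the last [2 ^ (r * N2)] stays on the right. *)
set P := \prod_(k <- _) k; case: (count_mem 1 _) => [|u] cube gap.
  rewrite mul0n muln1 -expnMn (leq_trans (_ : _ <= (OPT r * 8) ^ N0 tint)) //.
    by apply: expn_homo; rewrite mulnC (mulnC (OPT r)).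
  by rewrite expnMn leq_pmulr // expn_gt0.
rewrite -(@leq_exp2r _ _ 3) // !expnMn.
rewrite -(@leq_pmul2r (3 ^ (u * N0 tint))) ?expn_gt0 //.
have base : P ^ 3 * 9 ^ 3 * 3 ^ u <= OPT r ^ 3 * 8 ^ 3.
  have := expn3_le_OPT r_gt1; rewrite expnD (mulnC 512) => H.
  apply: leq_trans (leq_trans (leq_mul cube (leqnn (3 ^ 5))) H).
  by rewrite [9 ^ 3](_ : _ = 3 * 3 ^ 5) // (expnS 3 u); move: (3 ^ 5) (P ^ 3) (3 ^ u) => *; lia.
have pow : (P ^ N0 tint) ^ 3 * (9 ^ N0 tint) ^ 3 * 3 ^ (u * N0 tint) <=
    (OPT r ^ N0 tint) ^ 3 * (8 ^ N0 tint) ^ 3.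
  by rewrite !(expnAC _ (N0 tint) 3) (expnM 3 u) -!(expnMn _ _ (N0 tint)); apply: expn_homo.
(* Combines [2 ^ 3 <= 3 ^ 2] with the assumption that [N0] is at least twice [r * N2]. *)
have shar : (2 ^ (u * (r * N2))) ^ 3 <= 3 ^ (u * N0 tint).
  rewrite (expnAC _ _ 3) (@leq_trans (9 ^ (u * (r * N2)))) //.
    exact: expn_homo.
  by rewrite [9](_ : _ = 3 ^ 2) // -expnM leq_exp2l //; nia.
rewrite mulSn expnD expnMn.
move: (leq_mul pow (leq_mul shar (leqnn ((2 ^ (r * N2)) ^ 3)))).
move: (_ ^ 3) (_ ^ 3) (_ ^ 3) (_ ^ 3) (_ ^ 3) (_ ^ 3) (3 ^ _) => *; lia.
Qed.

(** Either some family meets [F] in few members, or all families are larger than [N1], hence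
    extremal, and only the multiplicities can fail to be optimal. *)
Lemma prod_coverage_atypical F l : size l = r -> {in l, forall A, maximal tint A} ->
  2 * (r * N2) <= N0 tint ->
  ~~ (optimal_solution r (multiplicities l) &&
      all (fun A => extremal tint A && (r * Nmax < #|F :&: A|)) (undup l)) ->
  (\prod_(x in F) coverage l x) * 9 ^ N0 tint <=
  OPT r ^ N0 tint * 8 ^ N0 tint * 2 ^ (r * Nmax).
Proof.
move=> size_l max_l N0_ge natyp.
have [/hasP[A Al small]|/hasPn large] := boolP (has (fun A : {set U} => #|F :&: A| <= r * Nmax) l).
  apply: prod_coverage_small Al small => // B /max_l.
  by move/maximal_t_intersecting/card_t_intersecting.
have ext_l A : A \in l -> extremal tint A.
  move=> Al; apply: maximal_large_extremal (max_l A Al) _.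
  have := large A Al; rewrite -ltnNge => large_A.
  apply: leq_trans (subset_leq_card (subsetIr F A)); apply: leq_ltn_trans large_A.
  by rewrite (leq_trans (leq_maxl _ N2)) // leq_pmull // ltnW.
apply: prod_coverage_nonoptimal => //; apply: contra natyp => ->.
by apply/allP=> A; rewrite mem_undup => Al; rewrite ext_l // ltnNge large.
Qed.

(** * Colourings with prescribed families containing the colour classes *)

Definition class_members F (f : 'I_r -> {set U}) :
    {set {ffun {x : U | x \in F} -> 'I_r}} :=
  [set c : {ffun {x : U | x \in F} -> 'I_r} | [forall x, val x \in f (c x)]].

(** Each [x] chooses its colour independently among the [i] with [x] in [f i]. *)
Lemma card_class_members F (f : 'I_r -> {set U}) :
  #|class_members F f| = \prod_(x in F) coverage [seq f i | i <- enum 'I_r] x.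
Proof.
pose Q (x : {x : U | x \in F}) : pred 'I_r := fun i => val x \in f i.
have -> : #|class_members F f| = #|family Q|.
  by apply: eq_card => c; rewrite inE; apply: eq_forallb.
rewrite big_sub (eq_bigr (fun x => \sum_(i | Q x i) 1)).
  by rewrite bigA_distr_big_dep -sum1_card; apply: eq_bigr => c _; rewrite big1_eq.
by move=> x _; rewrite /coverage count_map -sum1_count big_enum_cond.
Qed.

Lemma class_members_colourings F (f : 'I_r -> {set U}) :
  (forall i, t_intersecting tint (f i)) -> class_members F f \subset colourings tint r F.
Proof.
move=> tf; apply/subsetP=> c; rewrite !inE => /forallP cf; apply/forallP=> i.
apply: t_intersecting_sub (tf i); apply/subsetP=> _ /imsetP[x cx ->].
by move: cx; rewrite inE => /eqP <-.
Qed.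

(** Repeat extremal families according to an optimal solution and colour their union. Each family
    shares at most [(ceil3 r).-1 * N2] members with the others; the loss is kept on the right to
    avoid subtraction in the exponent. *)
Lemma max_colourings_ge : ceil3 r <= #|[set A | extremal tint A]| ->
  OPT r ^ N0 tint <= max_colourings tint r * OPT r ^ ((ceil3 r).-1 * N2).
Proof.
move=> many; have [m solm prodm] := OPT_attained r.
have optm : optimal_solution r m by rewrite /optimal_solution solm prodm /=.
have size_m : size m <= ceil3 r.
  have [-> //|[_ ->]] := size_optimal r_gt1 optm.
  by rewrite leq_div2r // leq_addr.
have /andP[posm /eqP summ] := solm.
have [|l [sub_l mult_l size_l]] :=
  exists_multiplicities (enum_uniq [set A | extremal tint A]) _ posm.
  by rewrite -cardE (leq_trans size_m).
rewrite summ in size_l.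
have ext_l A : A \in l -> extremal tint A by move/sub_l; rewrite mem_enum inE.
pose t := tcast size_l (in_tuple l).
have tE : [seq tnth t i | i <- enum 'I_r] = l.
  by rewrite map_tnth_enum val_tcast.
pose G := cover [set A in l].
have prodE n : (\prod_(A <- undup l) count_mem A l ^ n) = OPT r ^ n.
  rewrite -(big_morph (expn^~ n) (fun a b => expnMn a b n) (exp1n n)) -prodm -mult_l.
  by rewrite big_map.
have colG : \prod_(x in G) coverage l x <= max_colourings tint r.
  apply: leq_trans (@bigop.leq_bigmax _ (fun F => #|colourings tint r F|) G); rewrite -tE -card_class_members.
  apply/subset_leq_card/class_members_colourings => i.
  by have /ext_l/andP[] : tnth t i \in l by rewrite -tE map_f ?mem_enum.
apply: leq_trans (leq_mul colG (leqnn _)).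
have := prod_coverage_ge l.
have -> : \prod_(A <- undup l) count_mem A l ^ #|A| = OPT r ^ N0 tint.
  rewrite -prodE big_seq [RHS]big_seq; apply: eq_bigr => A; rewrite mem_undup.
  by move=> /ext_l/andP[_ /eqP ->].
move/leq_trans; apply; rewrite leq_mul2l -prodE; apply/orP; right.
rewrite big_seq [X in _ <= X]big_seq; apply: leq_prod => A Al.
rewrite leq_pexp2l ?count_mem_undup_gt0 //; rewrite mem_undup in Al.
apply: leq_trans (card_shared_le (n := N2) Al _) _.
  by move=> B Bl BA; apply: extremalI_le; rewrite ?ext_l // eq_sym.
have <- : size m = size (undup l) by rewrite -mult_l size_map.
by rewrite leq_mul2r -!subn1 leq_sub2r ?orbT.
Qed.

End Bounds.

(** * Atypical and typical colourings *)

Section Colourings.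

Variables (U : finType) (tint : rel U) (N2 r : nat).
Hypothesis extremalI_le : forall A B : {set U},
  extremal tint A -> extremal tint B -> A != B -> #|A :&: B| <= N2.
Hypothesis r_gt1 : 1 < r.
Variable Mx : {set U} -> {set U}.
Hypothesis MxP : assignment tint Mx.
Variable F : {set U}.

Let Nmax := maxn (N1 tint) N2.
Let colouring := {ffun {x : U | x \in F} -> 'I_r}.
Implicit Types c : colouring.

Lemma colour_classP c i : c \in colourings tint r F ->
  maximal tint (Mx (colour_class c i)) /\ colour_class c i \subset Mx (colour_class c i).
Proof. by rewrite inE => /forallP tc; apply: MxP. Qed.

Lemma mem_colour_class c x : val x \in colour_class c (c x).
Proof. by apply/imsetP; exists x; rewrite ?inE. Qed.

Lemma size_class_seq c : size (class_seq Mx c) = r.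
Proof. by rewrite size_map size_enum_ord. Qed.

(** The colourings are grouped by their sequence of maximal families; there are at most [M ^ r]
    sequences, and each group is bounded by a coverage product. *)
Lemma card_atypical M : #|[set A : {set U} | maximal tint A]| <= M ->
  2 * (r * N2) <= N0 tint ->
  #|atypical_colourings tint Mx N2 r F| * 9 ^ N0 tint <=
  M ^ r * (OPT r ^ N0 tint * 8 ^ N0 tint * 2 ^ (r * Nmax)).
Proof.
move=> leM N0_ge.
pose h c := [ffun i => Mx (colour_class c i)].
rewrite -sum1_card (partition_big h (mem (ffun_on (maximal tint)))) /=; last first.
  move=> c; rewrite inE => /andP[/colour_classP cP _].
  by apply/ffun_onP => i; rewrite ffunE; have [] := cP i.
rewrite big_distrl /=.
set B := _ * _ * _.
apply: (@leq_trans (\sum_(f in ffun_on (maximal tint) : pred {ffun 'I_r -> {set U}}) B)).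
  apply: leq_sum => f _; rewrite sum1dep_card.
  (* Typicality depends only on the sequence, so one member [c0] of a nonempty group shows that the
     sequence [f] is atypical. *)
  have [->|[c0]] := set_0Vmem [set c | (c \in atypical_colourings tint Mx N2 r F) && (h c == f)].
    by rewrite cards0.
  rewrite !inE => /andP[/andP[col0 atyp0] /eqP hc0].
  have seqE : class_seq Mx c0 = [seq f i | i <- enum 'I_r].
    by apply: eq_map => i; rewrite -hc0 ffunE.
  have := @prod_coverage_atypical U tint N2 r extremalI_le r_gt1 F (class_seq Mx c0).
  rewrite size_class_seq => /(_ erefl _ N0_ge atyp0) H.
  have {}H := H _; apply: leq_trans (H _); last first.
    by move=> _ /mapP[i _ ->]; have [] := colour_classP i (_ : c0 \in colourings tint r F);
       rewrite ?inE.
  rewrite leq_mul2r seqE -card_class_members subset_leq_card ?orbT //.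
  apply/subsetP=> c; rewrite !inE => /andP[/andP[colc _] /eqP hc]; apply/forallP=> x.
  have [] := colour_classP (c x) (_ : c \in colourings tint r F); first by rewrite inE.
  by rewrite -hc ffunE => _ /subsetP; apply; apply: mem_colour_class.
rewrite sum_nat_const leq_mul2r card_ffun_on card_ord; apply/orP; right.
by apply: expn_homo; apply: leq_trans leM; rewrite cardsE.
Qed.

Lemma class_seq_cover c x : c \in colourings tint r F -> x \in F ->
  exists2 B, B \in class_seq Mx c & x \in B.
Proof.
move=> colc xF; pose z : {x : U | x \in F} := exist _ x xF.
exists (Mx (colour_class c (c z))); first by rewrite map_f ?mem_enum.
by have [_ /subsetP] := colour_classP (c z) colc; apply; apply: (mem_colour_class c z).
Qed.

(* A large extremal family missing from class_seq Mx d would meet F only inside at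
   most r other extremal families, hence in at most r * N2 members. *)
Lemma typical_class_seq_sub c d : typical tint Mx N2 c -> typical tint Mx N2 d ->
  d \in colourings tint r F -> {subset class_seq Mx c <= class_seq Mx d}.
Proof.
case/andP=> _ /allP typc /andP[_ /allP typd] cold A Ac.
have /andP[extA] : extremal tint A && (r * Nmax < #|F :&: A|).
  by apply: typc; rewrite mem_undup.
apply: contraTT => Ad; rewrite -leqNgt.
have extd B : B \in class_seq Mx d -> extremal tint B.
  by move=> Bd; have /andP[] := typd B (etrans (mem_undup _ _) Bd).
have sub : F :&: A \subset shared (A :: class_seq Mx d) A.
  apply/subsetP=> x; rewrite inE => /andP[xF xA]; rewrite inE xA.
  have [B Bd xB] := class_seq_cover cold xF.
  apply/hasP; exists B; first by rewrite inE Bd orbT.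
  by rewrite xB andbT; apply: contraNneq Ad => <-.
apply: leq_trans (subset_leq_card sub) _.
apply: leq_trans (card_shared_le (n := N2) (mem_head _ _) _) _.
  move=> B; rewrite inE => /predU1P[->|Bd BA]; first by rewrite eqxx.
  by apply: extremalI_le; [|exact: extd|rewrite eq_sym].
(* The predecessor in the bound discounts [A] itself, leaving at most [r] other families. *)
rewrite /= (negPf Ad) /=; apply: leq_mul; last exact: leq_maxr.
by rewrite -[X in _ <= X](size_class_seq d) size_undup.
Qed.

(** * Extending typical colourings by a new member *)

Definition extend_colouring (y : U) c (i : 'I_r) : {ffun {x : U | x \in y |: F} -> 'I_r} :=
  [ffun x => if insub (val x) : option {x : U | x \in F} is Some z then c z else i].

Lemma extend_colouring_inj y c d i j : y \notin F ->
  extend_colouring y c i = extend_colouring y d j -> c = d /\ i = j.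
Proof.
move=> yF /ffunP eq_cd; split.
  apply/ffunP=> z; have zyF : val z \in y |: F by rewrite !inE (valP z) orbT.
  by have := eq_cd (exist _ (val z) zyF); rewrite !ffunE /= valK.
by have := eq_cd (exist _ y (setU11 y F)); rewrite !ffunE /= insubN.
Qed.

(** Every class of the extension still lies in the maximal family assigned to the old class of that
    colour. *)
Lemma extend_colouring_colourings y c i : c \in colourings tint r F ->
  y \in Mx (colour_class c i) -> extend_colouring y c i \in colourings tint r (y |: F).
Proof.
move=> colc yM; rewrite inE; apply/forallP=> j.
have [/maximal_t_intersecting tM /subsetP sM] := colour_classP j colc.
apply: t_intersecting_sub tM; apply/subsetP=> _ /imsetP[x xj ->].
move: xj; rewrite inE ffunE; case: insubP => [z _ <- /eqP <-|xF /eqP <-].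
  by have [_ /subsetP] := colour_classP (c z) colc; apply; apply: mem_colour_class.
by have := valP x; rewrite !inE (negPf xF) orbF => /eqP ->.
Qed.

(** Parts of an optimal solution are at least 2, so a family containing [y] is assigned to at least
    two colours, each available for [y]. *)
Lemma typical_extension y : y \notin F ->
  (forall c, c \in colourings tint r F -> typical tint Mx N2 c ->
    exists2 A, A \in class_seq Mx c & y \in A) ->
  2 * #|[set c in colourings tint r F | typical tint Mx N2 c]| <=
  #|colourings tint r (y |: F)|.
Proof.
move=> yF typ_y; set T := [set c in _ | _].
pose P := [set p : colouring * 'I_r | (p.1 \in T) && (y \in Mx (colour_class p.1 p.2))].
pose e (p : colouring * 'I_r) := extend_colouring y p.1 p.2.
have e_inj : injective e.
  by move=> [c i] [d j] eq_e; have [/= -> ->] := extend_colouring_inj yF eq_e.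
have sub : e @: P \subset colourings tint r (y |: F).
  apply/subsetP=> _ /imsetP[p pP ->]; rewrite inE in pP.
  have /andP[/setIdP[colc _] yM] := pP.
  exact: extend_colouring_colourings.
apply: leq_trans (subset_leq_card sub); rewrite (card_imset _ e_inj).
have -> : #|P| = \sum_(c in T) \sum_(i | y \in Mx (colour_class c i)) 1.
  by rewrite pair_big_dep /= -sum1_card; apply: eq_bigl => p; rewrite inE.
rewrite mulnC -sum_nat_const; apply: leq_sum => c; rewrite inE => /andP[colc typc].
have [A Ac yA] := typ_y c colc typc.
have /andP[optc _] := typc.
have : 1 < count_mem A (class_seq Mx c).
  by apply: (optimal_parts_ge2 r_gt1 optc); apply/mapP; exists A; rewrite ?mem_undup.
rewrite count_map -sum1_count big_enum_cond /=.
move/leq_trans; apply; rewrite big_mkcond [X in _ <= X]big_mkcond.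
by apply: leq_sum => i _ /=; case: eqP => // ->; rewrite yA.
Qed.

Lemma union_of_typical :
  3 * #|atypical_colourings tint Mx N2 r F| < #|colourings tint r F| ->
  3 * max_colourings tint r < 4 * #|colourings tint r F| ->
  union_of_extremal tint (ceil3 r) F \/
  (r = 1 %[mod 3] /\ union_of_extremal tint (r %/ 3) F).
Proof.
move=> few_atyp large_F.
set T := [set c in colourings tint r F | typical tint Mx N2 c].
have colE : #|colourings tint r F| = #|T| + #|atypical_colourings tint Mx N2 r F|.
  rewrite -(cardsID [set c | typical tint Mx N2 c]); congr (_ + _).
    by apply: eq_card => c; rewrite !inE.
  by apply: eq_card => c; rewrite !inE andbC.
(* More than two thirds of the colourings of [F] are typical. *)
have /card_gt0P[c] : 0 < #|T| by lia.
rewrite inE => /andP[colc typc]; have /andP[optc /allP extc] := typc.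
pose S := [set A in class_seq Mx c].
have extS A : A \in S -> extremal tint A.
  by rewrite inE -mem_undup => /extc/andP[].
have sizeS : #|S| = size (multiplicities (class_seq Mx c)).
  by rewrite /S size_map -(card_uniqP (undup_uniq _)) cardsE; apply: eq_card => A; rewrite mem_undup.
have coverS : F = cover S.
  apply/eqP; rewrite eqEsubset; apply/andP; split; apply/subsetP=> y.
    move/(class_seq_cover colc) => [A Ac yA].
    by apply/bigcupP; exists A; rewrite ?inE.
  case/bigcupP=> A; rewrite inE => Ac yA; apply: contraT => yF.
  have := typical_extension yF; rewrite -/T => H.
  have {}H : 2 * #|T| <= #|colourings tint r (y |: F)|.
    by apply: H => d cold typd; exists A; rewrite // (typical_class_seq_sub typc typd).
  (* Doubling the typical colourings gives [y |: F] more than 4/3 as many colourings as [F], which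
     exceeds the maximum. *)
  have := @bigop.leq_bigmax _ (fun F => #|colourings tint r F|) (y |: F).
  by rewrite -/(max_colourings tint r); lia.
have [sz|[rE sz]] := size_optimal r_gt1 optc; [left|right; split=> //].
  by exists S; split; rewrite // sizeS.
by exists S; split; rewrite // sizeS.
Qed.

End Colourings.

(** * Real estimates drawn from the size of [Delta] *)

Local Open Scope ring_scope.

Section Delta.

Variables (R : realType) (U : finType) (tint : rel U) (r N2 M : nat).
Local Notation Nmax := (maxn (N1 tint) N2).
Local Notation Delta := (Delta tint R r N2 M).

Lemma ln2_gt0 : 0 < ln 2 :> R.
Proof. by rewrite ln_gt0 // ltr1n. Qed.

(** Scaling by [ln 2] clears the base-2 logarithms, so that later estimates are linear in natural
    logarithms. *)
Lemma Delta_ln2 : Delta * ln 2 =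
  (N0 tint)%:R * (ln 9 - 3 * ln 2) - r%:R * Nmax%:R * ln 2
  - r%:R * N2%:R / 3 * ln (OPT r)%:R - r%:R * ln M%:R :> R.
Proof. by rewrite /Delta /log2; field; rewrite gt_eqF // ln2_gt0. Qed.

Lemma powR2_Delta : 2 `^ (2 - Delta) = 4 * expR (- (Delta * ln 2)) :> R.
Proof.
rewrite /powR pnatr_eq0 /= mulrBl expRB expRN; congr (_ / _).
by rewrite mulrC expRM_natr lnK ?posrE ?ltr0n // -natrX.
Qed.

Lemma natr_expn_ln (a n : nat) : (0 < a)%N -> (a ^ n)%:R = expR (n%:R * ln a%:R) :> R.
Proof. by move=> a_gt0; rewrite expRM_natl lnK ?posrE ?ltr0n // natrX. Qed.

(** Positivity of [Delta] gives r N2 <= (log2 9 - 3) N0, and log2 9 - 3 <= 1/3 because 9^3 <=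
    2^10. *)
Lemma N0_ge_of_Delta : (0 < M)%N -> 2 <= Delta -> (2 * (r * N2) <= N0 tint)%N.
Proof.
move=> M_gt0 Delta_ge2.
have ln2 := ln2_gt0.
have lnO : 0 <= ln (OPT r)%:R :> R by rewrite ln_ge0 // ler1n OPT_gt0.
have lnM : 0 <= ln M%:R :> R by rewrite ln_ge0 // ler1n.
have ln9 : 3 * ln 9 <= 10 * ln 2 :> R.
  rewrite !mulr_natl -!lnXn ?ltr0n // ler_ln ?posrE ?exprn_gt0 ?ltr0n //.
  by rewrite -!natrX ler_nat.
have : 2 * ln 2 <= Delta * ln 2 by rewrite ler_pM2r.
rewrite Delta_ln2.
have h1 : 0 <= r%:R * N2%:R / 3 * ln (OPT r)%:R :> R by rewrite !mulr_ge0 ?invr_ge0.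
have h2 : 0 <= r%:R * ln M%:R :> R by rewrite mulr_ge0.
have h3 : r%:R * N2%:R * ln 2 <= r%:R * Nmax%:R * ln 2 :> R.
  apply: ler_wpM2r; first exact: ltW.
  by apply: ler_wpM2l => //; rewrite ler_nat leq_maxr.
have h4 : 3 * ((N0 tint)%:R * (ln 9 - 3 * ln 2)) <= (N0 tint)%:R * ln 2 :> R.
  by have := ler_wpM2l (ler0n R (N0 tint)) ln9; lra.
move=> h5.
have : 3 * (r%:R * N2%:R) * ln 2 <= (N0 tint)%:R * ln 2 :> R by lra.
rewrite ler_pM2r // -!natrM ler_nat; lia.
Qed.

(** The two counting bounds give a/m <= M^r OPT(r)^(k N2) (8/9)^N0 2^(r Nmax); since k <= r/3, the
    base-2 logarithm of the right side is at most -[Delta]. *)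
Lemma atypical_le_of_Delta (a m k : nat) : (0 < M)%N -> (3 * k <= r)%N ->
  (a * 9 ^ N0 tint <= M ^ r * (OPT r ^ N0 tint * 8 ^ N0 tint * 2 ^ (r * Nmax)))%N ->
  (OPT r ^ N0 tint <= m * OPT r ^ (k * N2))%N ->
  a%:R <= m%:R * expR (- (Delta * ln 2)) :> R.
Proof.
move=> M_gt0 k_le atyp lower.
have {}atyp : (a * 9 ^ N0 tint <=
    m * (M ^ r * OPT r ^ (k * N2) * 2 ^ (3 * N0 tint) * 2 ^ (r * Nmax)))%N.
  apply: leq_trans atyp _; rewrite (expnM 2 3).
  apply: leq_trans (leq_mul (leqnn _) (leq_mul (leq_mul lower (leqnn _)) (leqnn _))) _.
  by apply: eq_leq; move: (_ ^ _)%N (_ ^ _)%N (_ ^ _)%N (_ ^ _)%N => *; lia.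
rewrite -(ler_pM2r (expR_gt0 ((N0 tint)%:R * ln 9))) -mulrA -expRD.
rewrite -(natr_expn_ln (a := 9)) // -natrM.
apply: le_trans (_ : _ <= (m * (M ^ r * OPT r ^ (k * N2) * 2 ^ (3 * N0 tint) * 2 ^ (r * Nmax)))%:R) _.
  by rewrite ler_nat.
rewrite natrM; apply: ler_wpM2l => //; rewrite !natrM !natr_expn_ln ?OPT_gt0 // -!expRD ler_expR Delta_ln2.
have lnO : 0 <= ln (OPT r)%:R :> R by rewrite ln_ge0 // ler1n OPT_gt0.
have : (k * N2)%:R * ln (OPT r)%:R <= r%:R * N2%:R / 3 * ln (OPT r)%:R :> R.
  apply: ler_wpM2r => //; rewrite ler_pdivlMr ?ltr0n // -!natrM ler_nat; nia.
rewrite !natrM; lra.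
Qed.

End Delta.

(** * The proportion of atypical colourings and the structure of [F] *)

Theorem theorem3p3 (R : realType) (r t : nat) (hr : (4 <= r)%N) (ht : (1 <= t)%N)
  (U : finType) (tint : nat -> rel U) (tint_sym : symmetric (tint t))
  (N2 M : nat)
  (hN2 : forall A B : {set U}, extremal (tint t) A -> extremal (tint t) B ->
     A != B -> (#|A :&: B| <= N2)%N)
  (hext : (ceil3 r <= #|[set A : {set U} | extremal (tint t) A]|)%N)
  (hM : (#|[set A : {set U} | maximal (tint t) A]| <= M)%N)
  (Mx : {set U} -> {set U}) (hMx : assignment (tint t) Mx)
  (hDelta : 2 <= Delta (tint t) R r N2 M)
  (F : {set U})
  (hF : 3 / 4 * (max_colourings (tint t) r)%:R
          < #|colourings (tint t) r F|%:R :> R) :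
  (union_of_extremal (tint t) (ceil3 r) F \/
   (r = 1 %[mod 3] /\ union_of_extremal (tint t) (r %/ 3) F)) /\
  #|atypical_colourings (tint t) Mx N2 r F|%:R
    / #|colourings (tint t) r F|%:R
    < 2 `^ (2 - Delta (tint t) R r N2 M) / 3 :> R.
Proof.
have r_gt1 : (1 < r)%N by lia.
have M_gt0 : (0 < M)%N.
  (* The empty family is contained in a maximal one, so [ln M%:R] is nonnegative. *)
  apply: leq_trans hM; apply/card_gt0P; exists (Mx set0).
  rewrite inE; have [] // := hMx set0.
  by apply/forall_inP=> x; rewrite inE.
have N0_ge := N0_ge_of_Delta M_gt0 hDelta.
have k_le : (3 * (ceil3 r).-1 <= r)%N by rewrite /ceil3; lia.
have atyp := atypical_le_of_Delta R M_gt0 k_le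
  (card_atypical hN2 r_gt1 hMx F hM N0_ge) (max_colourings_ge hN2 r_gt1 hext).
set Dl := Delta (tint t) R r N2 M in hDelta atyp *.
set a := #|atypical_colourings _ _ _ _ _| in atyp *.
set c := #|colourings _ _ _| in hF *.
set m := max_colourings _ _ in hF atyp.
have c_gt0 : 0 < c%:R :> R by apply: le_lt_trans hF; rewrite !mulr_ge0 ?invr_ge0 ?ler0n.
have e_gt0 := expR_gt0 (- (Dl * ln 2)).
have ratio : a%:R / c%:R < 2 `^ (2 - Dl) / 3 :> R.
  (* The maximum is below 4/3 of [c], and 4/3 times 2^(-[Dl]) is the claimed bound. *)
  rewrite ltr_pdivrMr // powR2_Delta -/Dl; apply: le_lt_trans atyp _.
  have : 3 / 4 * m%:R * expR (- (Dl * ln 2)) < c%:R * expR (- (Dl * ln 2)) :> R.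
    by rewrite ltr_pM2r.
  by lra.
split=> //; apply: (union_of_typical hN2 r_gt1 hMx).
  (* With [Dl] at least 2 the proportion is below 1/3, as [union_of_typical] requires. *)
  have small : 2 `^ (2 - Dl) / 3 <= 1 / 3 :> R.
    have : 2 `^ (2 - Dl) <= 2 `^ 0 :> R.
      by apply: ler_powR; [rewrite ler1n | rewrite subr_le0].
    by rewrite powRr0; lra.
  have := lt_le_trans ratio small; rewrite ltr_pdivrMr // => H.
  have : (3 * a)%:R < c%:R :> R by rewrite natrM; lra.
  by rewrite ltr_nat.
have : (3 * m)%:R < (4 * c)%:R :> R by rewrite !natrM; lra.
by rewrite ltr_nat.
Qed.
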